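(* Let $n\ge 1$, $r>0$, $\sigma_1,\sigma_2>0$, $L>0$, $x_1^*=(-r,0,\dots,0)\in\mathbb{R}^n$, $x_2^*=(r,0,\dots,0)\in\mathbb{R}^n$, and let $\hat{\mathcal{M}}\subset\mathbb{R}^n$ and $\mathcal{T}_n\subset\mathbb{R}^n$ be the sets defined in the context. If $$r\le \frac{L}{2}\cdot\min\Big\{\frac{1}{\sigma_1},\frac{1}{\sigma_2}\Big\},$$ then the boundary of $\hat{\mathcal{M}}$ is $$\partial\hat{\mathcal{M}}=\mathcal{T}_n\cup\{x_1^*,x_2^*\}.$$
   Context: Write $\|\cdot\|$ for the Euclidean norm, $\partial\mathcal{E}=\bar{\mathcal{E}}\setminus\mathcal{E}^\circ$ for the boundary of a set $\mathcal E$, and $\angle(u,v)=\arccos\big(\frac{u^Tv}{\|u\|\|v\|}\big)$ for nonzero $u,v\in\mathbb{R}^n$. For $i\in\{1,2\}$ and $x$ with $\frac{\sigma_i}{L}\|x-x_i^*\|\le 1$ put $\tilde\phi_i(x)=\arccos\big(\frac{\sigma_i}{L}\|x-x_i^*\|\big)$. For $x\notin\{x_1^*,x_2^*\}$ put $\alpha_i(x)=\angle(x-x_i^*,\,x_2^*-x_1^* )$ and $\psi(x)=\pi-(\alpha_2(x)-\alpha_1(x))$. Define $$\hat{\mathcal{M}}=\Big\{x\in\mathbb{R}^n:\ \tilde\phi_1(x)+\tilde\phi_2(x)\ge\psi(x),\ \|x-x_1^*\|\le\tfrac{L}{\sigma_1},\ \|x-x_2^*\|\le\tfrac{L}{\sigma_2}\Big\},$$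 where the points $x_1^*,x_2^*$, at which $\psi$ is undefined, are regarded as not belonging to $\hat{\mathcal M}$. Write points of $\mathbb{R}^n$ as $(z_1,\mathbf z)$ with $z_1\in\mathbb{R}$, $\mathbf z\in\mathbb{R}^{n-1}$, and put $d_1=\sqrt{(z_1+r)^2+\|\mathbf z\|^2}$, $d_2=\sqrt{(z_1-r)^2+\|\mathbf z\|^2}$. Define $$\mathcal{T}_n=\Big\{(z_1,\mathbf z)\in\mathbb{R}^n:\ \frac{z_1^2+\|\mathbf z\|^2-r^2}{d_1^2d_2^2}+\frac{\sigma_1\sigma_2}{L^2}=\sqrt{\frac1{d_1^2}-\frac{\sigma_1^2}{L^2}}\cdot\sqrt{\frac1{d_2^2}-\frac{\sigma_2^2}{L^2}}\Big\},$$ where only points at which all expressions are defined are considered (i.e. $0<d_i\le L/\sigma_i$ for $i=1,2$). *)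

(* Defs.v *)
From mathcomp Require Import all_boot all_order all_algebra.
From mathcomp Require Import all_classical all_reals all_analysis.

Set Implicit Arguments.
Unset Strict Implicit.
Unset Printing Implicit Defensive.

Import Order.TTheory GRing.Theory Num.Theory.
Import numFieldNormedType.Exports.

Local Open Scope classical_set_scope.
Local Open Scope ring_scope.

Definition dotp {R : realType} {n : nat} (u v : 'rV[R]_n) : R :=
  \sum_(i < n) u 0 i * v 0 i.

(* The library norm `|u| on 'rV[R]_n is the sup norm, so the Euclidean norm is
   defined separately; the two induce the same topology. *)
Definition enorm {R : realType} {n : nat} (u : 'rV[R]_n) : R :=
  Num.sqrt (dotp u u).

Definition boundary {T : topologicalType} (E : set T) : set T :=
  closure E `\` E°.

(* Meaningful for nonzero u and v only. *)
Definition angle {R : realType} {n : nat} (u v : 'rV[R]_n) : R :=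
  acos (dotp u v / (enorm u * enorm v)).

(* Meaningful only when sigma / L * enorm (x - a) <= 1. *)
Definition phit {R : realType} {n : nat} (sigma L : R) (a x : 'rV[R]_n) : R :=
  acos (sigma / L * enorm (x - a)).

(* Meaningful only when x differs from x1 and x2. *)
Definition psi {R : realType} {n : nat} (x1 x2 x : 'rV[R]_n) : R :=
  pi - (angle (x - x2) (x2 - x1) - angle (x - x1) (x2 - x1)).

(* The first two conditions exclude the points where psi is undefined; the next
   two say that x lies in the domain of both functions phit. *)
Definition Mhat {R : realType} {n : nat} (sigma1 sigma2 L : R)
    (x1 x2 : 'rV[R]_n) : set 'rV[R]_n :=
  [set x | [/\ x != x1, x != x2,
               enorm (x - x1) <= L / sigma1,
               enorm (x - x2) <= L / sigma2
             & phit sigma1 L x1 x + phit sigma2 L x2 x >= psi x1 x2 x]].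

(* The point (c, 0, ..., 0) of R^(n+1). *)
Definition axis_point {R : realType} {n : nat} (c : R) : 'rV[R]_n.+1 :=
  \row_(j < n.+1) (if j == ord0 then c else 0).

(* A point x of R^(n+1) is read as (z1, z) with z1 = x 0 0 and z = col' ord0 x
   the remaining n coordinates.  The bounds on d1 and d2 say that both
   denominators are nonzero and both radicands nonnegative. *)
Definition Tset {R : realType} {n : nat} (r sigma1 sigma2 L : R) :
    set 'rV[R]_n.+1 :=
  [set x : 'rV[R]_n.+1 | let z1 := x 0 0 in
           let z := col' ord0 x in
           let d1 := Num.sqrt ((z1 + r) ^+ 2 + enorm z ^+ 2) in
           let d2 := Num.sqrt ((z1 - r) ^+ 2 + enorm z ^+ 2) in
           [/\ 0 < d1 <= L / sigma1,
               0 < d2 <= L / sigma2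
             & (z1 ^+ 2 + enorm z ^+ 2 - r ^+ 2) / (d1 ^+ 2 * d2 ^+ 2)
                 + sigma1 * sigma2 / L ^+ 2
               = Num.sqrt (1 / d1 ^+ 2 - sigma1 ^+ 2 / L ^+ 2)
                 * Num.sqrt (1 / d2 ^+ 2 - sigma2 ^+ 2 / L ^+ 2)]].

(* Main.v *)
Require Import Defs.
From mathcomp Require Import all_boot all_order all_algebra.
From mathcomp Require Import all_classical all_reals all_analysis.
From mathcomp Require Import ring lra.

Set Implicit Arguments.
Unset Strict Implicit.
Unset Printing Implicit Defensive.

Import Order.TTheory GRing.Theory Num.Theory.
Import numFieldNormedType.Exports.

Local Open Scope classical_set_scope.
Local Open Scope ring_scope.

(** Put s_i = sigma_i / L, let d_i be the distance from x to the focus x_i^*,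
and let gamma = alpha_2 - alpha_1, which is the angle under which x sees the
segment joining the foci.  The angles phi_1 + phi_2 and psi = pi - gamma both
lie in [0, pi], where the cosine decreases, so phi_1 + phi_2 >= psi amounts to
cos (phi_1 + phi_2) + cos gamma <= 0.  The left-hand side is the function
[gap], equal to
  p / (d_1 d_2) + s_1 d_1 s_2 d_2
    - sqrt (1 - (s_1 d_1)^2) sqrt (1 - (s_2 d_2)^2),   p = |x|^2 - r^2.
Hence the region is gap <= 0 on the set where 0 < d_i <= 1 / s_i ([MhatE]);
dividing by d_1 d_2 shows that T_n is the level set gap = 0 there ([TsetE]).

It remains to see that the boundary of this sublevel set is the level set plus
the two foci ([boundary_sublevel]).

- On the open segment between the foci gamma = pi, and 2 r s_i <= 1 forces
  gap < 0 ([gap_segment_lt0]); so both foci are limits of points of the region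
  ([focus_closure]), and they do not belong to it.  By continuity of gap away
  from the foci, there are no other limit points ([closure_sublevel]).

- Where s_i d_i = 1 the root term of gap vanishes, while d_i >= 2 r makes
  gamma non-obtuse, so gap > 0 ([defect_rim_gt0]).  A point with gap < 0
  therefore satisfies d_i < 1 / s_i strictly and is interior
  ([gap_lt0_interior]).

- At a point with gap = 0 some ray leaves the region at once
  ([gap_eq0_not_interior]).  When p >= 0, move straight away from the first
  focus: d_1 and d_2 grow and gamma does not increase ([defect_radial_lt]).  When p < 0
  and x is off the axis, move perpendicularly away from the axis: again d_1 and
  d_2 grow and gamma decreases ([defect_transverse_lt]).  When p < 0 and x is on
  the axis, x is between the foci, where gap cannot vanish. *)

(** * Angles and distances in the half-plane through the axis *)

(** Rotating about the axis reduces everything to a half-plane: a is the axial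
offset from a focus and q the squared distance to the axis.  Below, a and b are
the offsets from the first and the second focus. *)
Definition rho {R : realType} (a q : R) : R := Num.sqrt (a ^+ 2 + q).

Lemma rho_sqr (R : realType) (a q : R) : 0 <= q -> rho a q ^+ 2 = a ^+ 2 + q.
Proof. by move=> q0; rewrite sqr_sqrtr// addr_ge0// sqr_ge0. Qed.

Lemma rho_ge0 (R : realType) (a q : R) : 0 <= rho a q.
Proof. exact: sqrtr_ge0. Qed.

Lemma norm_le_rho (R : realType) (a q : R) : 0 <= q -> `|a| <= rho a q.
Proof. by move=> q0; rewrite -sqrtr_sqr ler_wsqrtr// lerDl. Qed.

Lemma cos_ratio_itv (R : realType) (a q : R) : 0 <= q -> 0 < rho a q ->
  -1 <= a / rho a q <= 1.
Proof.
move=> q0 d0; have := norm_le_rho a q0.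
by rewrite ler_norml ler_pdivlMr// ler_pdivrMr// mulN1r mul1r.
Qed.

Lemma sin_acos_ratio (R : realType) (a q : R) : 0 <= q -> 0 < rho a q ->
  sin (acos (a / rho a q)) = Num.sqrt q / rho a q.
Proof.
move=> q0 d0; rewrite sin_acos ?cos_ratio_itv//.
have -> : 1 - (a / rho a q) ^+ 2 = q * (rho a q)^-1 ^+ 2.
  rewrite exprMn exprVn rho_sqr//; field.
  by rewrite -rho_sqr// sqrf_eq0 gt_eqF.
by rewrite sqrtrM// sqrtr_sqr ger0_norm// invr_ge0 ltW.
Qed.

(** The direction to a fixed point turns away from the positive axis as the
viewpoint moves along the axis in the positive direction.  This makes gamma
nonnegative, so that its cosine determines it. *)
Lemma acos_ratio_le (R : realType) (a b q : R) : 0 <= q ->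
  0 < rho a q -> 0 < rho b q -> b <= a ->
  acos (a / rho a q) <= acos (b / rho b q).
Proof.
move=> q0 d1 d2 ba.
have [h1 h2] := (cos_ratio_itv q0 d1, cos_ratio_itv q0 d2).
rewrite leNgt; apply/negP.
rewrite -ltr_cos ?in_itv/= ?acos_ge0 ?acos_lepi// !acosK// ltr_pdivrMr//.
rewrite mulrAC ltr_pdivlMr// => H.
have : 0 < rho a q + rho b q by rewrite addr_gt0.
have [D1 D2] := (rho_sqr a q0, rho_sqr b q0).
move: H D1 D2 d1 d2; move: (rho a q) (rho b q) => d e H D1 D2 d1 d2 _.
(* H reads a d2 < b d1; it is squared when a and b have the same sign *)
have [b0|b0] := leP 0 b.
  have a0 : 0 <= a by exact: le_trans ba.
  have : (a * e) ^+ 2 < (b * d) ^+ 2 by rewrite ltrXn2r// mulr_ge0// ltW.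
  rewrite !exprMn D1 D2.
  have : 0 <= q * (a ^+ 2 - b ^+ 2).
    by rewrite mulr_ge0// subr_ge0 lerXn2r// nnegrE.
  lra.
have [a0|a0] := leP 0 a.
  have : 0 <= a * e by rewrite mulr_ge0// ltW.
  have : b * d < 0 by rewrite nmulr_rlt0.
  lra.
have : (- b * d) ^+ 2 < (- a * e) ^+ 2.
  by rewrite ltrXn2r// ?mulr_ge0 ?oppr_ge0 ?ltW// !mulNr ltrN2.
rewrite !exprMn !sqrrN D1 D2.
have : 0 <= q * ((- b) ^+ 2 - (- a) ^+ 2).
  by rewrite mulr_ge0// subr_ge0 lerXn2r// ?nnegrE ?oppr_ge0 ?lerN2// ltW.
rewrite !sqrrN; lra.
Qed.

(** Both directions lie in the same half-plane, with sines sqrt q / d_i, so the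
subtraction formula yields the inner product of the two offset vectors. *)
Lemma cos_subtended (R : realType) (a b q : R) : 0 <= q ->
  0 < rho a q -> 0 < rho b q ->
  cos (acos (b / rho b q) - acos (a / rho a q))
    = (a * b + q) / (rho a q * rho b q).
Proof.
move=> q0 d1 d2.
rewrite cosB !acosK ?in_itv/= ?cos_ratio_itv// !sin_acos_ratio//.
have -> : b / rho b q * (a / rho a q)
    + Num.sqrt q / rho b q * (Num.sqrt q / rho a q)
  = (a * b + Num.sqrt q ^+ 2) / (rho a q * rho b q).
  by field; rewrite !gt_eqF.
by rewrite sqr_sqrtr.
Qed.

(** This is cos gamma + cos (phi_1 + phi_2), where p / (d1 d2) is cos gamma. *)
Definition defect {R : realType} (s1 s2 p d1 d2 : R) : R :=
  p / (d1 * d2) + s1 * d1 * (s2 * d2)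
  - Num.sqrt (1 - (s1 * d1) ^+ 2) * Num.sqrt (1 - (s2 * d2) ^+ 2).

(** Since 0 <= s_i d_i <= 1, each phi_i is at most pi / 2; so both sides of the
inequality lie in [0, pi], where the cosine reverses the order. *)
Lemma angle_condition (R : realType) (s1 s2 a b q : R) : 0 <= q ->
  0 < s1 -> 0 < s2 -> 0 < rho a q -> 0 < rho b q -> b <= a ->
  s1 * rho a q <= 1 -> s2 * rho b q <= 1 ->
  (pi - (acos (b / rho b q) - acos (a / rho a q))
     <= acos (s1 * rho a q) + acos (s2 * rho b q))
  = (defect s1 s2 (a * b + q) (rho a q) (rho b q) <= 0).
Proof.
move=> q0 s10 s20 d1 d2 ba u1 u2.
have v1 : 0 <= s1 * rho a q by rewrite mulr_ge0 ?ltW.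
have v2 : 0 <= s2 * rho b q by rewrite mulr_ge0 ?ltW.
have i1 : -1 <= s1 * rho a q <= 1 by rewrite u1 (le_trans _ v1)// lerN10.
have i2 : -1 <= s2 * rho b q <= 1 by rewrite u2 (le_trans _ v2)// lerN10.
have [h1 h2] := (cos_ratio_itv q0 d1, cos_ratio_itv q0 d2).
have half y : 0 <= y <= 1 -> acos y <= (pi : R) / 2.
  move=> /andP[y0 y1]; have iy : -1 <= y <= 1 by rewrite y1 (le_trans _ y0)// lerN10.
  have p0 := @pi_gt0 R.
  rewrite leNgt -ltr_cos ?in_itv/= ?acos_ge0 ?acos_lepi//; last by lra.
  by rewrite cos_pihalf acosK ?in_itv//= -leNgt.
have [f1 f2] : acos (s1 * rho a q) <= pi / 2 /\ acos (s2 * rho b q) <= pi / 2.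
  by rewrite !half ?v1 ?v2.
have [g1 g2] := (acos_ge0 i1, acos_ge0 i2).
have a1 := acos_ge0 h1; have a2 := acos_lepi h2.
have a12 := acos_ratio_le q0 d1 d2 ba.
rewrite leNgt -ltr_cos ?in_itv/=; last 2 first.
- by apply/andP; split; lra.
- by apply/andP; split; lra.
rewrite -leNgt cosB cospi sinpi mul0r addr0 mulN1r cos_subtended//.
rewrite cosD !acosK ?in_itv//= !sin_acos//.
rewrite -[in RHS](lerD2l (- ((a * b + q) / (rho a q * rho b q)))).
by rewrite addr0 /defect !addrA addNr add0r.
Qed.

(** The part cos (phi_1 + phi_2) increases with both distances, because each phi_i
decreases; so it suffices to control cos gamma.  The formula keeps this
monotonicity beyond d_i = 1 / s_i, where the square root is 0 by convention. *)
Lemma defect_lt (R : realType) (s1 s2 p p' d1 d1' d2 d2' : R) :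
  0 < s1 -> 0 < s2 -> 0 < d1 -> d1 < d1' -> 0 < d2 -> d2 <= d2' ->
  p / (d1 * d2) <= p' / (d1' * d2') ->
  defect s1 s2 p d1 d2 < defect s1 s2 p' d1' d2'.
Proof.
move=> s10 s20 d10 dd1 d20 dd2 hp; rewrite /defect.
apply: ltr_leB.
  apply: ler_ltD => //.
  apply: (@lt_le_trans _ _ (s1 * d1' * (s2 * d2))).
    by rewrite ltr_pM2r ?mulr_gt0// ltr_pM2l.
  by rewrite !ler_pM2l ?mulr_gt0// (lt_trans d10).
have mono (s d d' : R) : 0 < s -> 0 < d -> d <= d' ->
    Num.sqrt (1 - (s * d') ^+ 2) <= Num.sqrt (1 - (s * d) ^+ 2).
  move=> s0 d0 dd'; rewrite ler_wsqrtr// lerB// lerXn2r// ?nnegrE.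
  - by rewrite mulr_ge0// ltW.
  - by rewrite mulr_ge0// ltW// (lt_le_trans d0).
  - by rewrite ler_pM2l.
by apply: ler_pM; rewrite ?sqrtr_ge0// mono// ltW.
Qed.

(** On a ray from the first focus, d1 scales by 1 + t and d2 does not decrease, as
p >= 0 says that the ray does not approach the second focus.  That cos gamma
does not decrease follows by squaring from p <= d1 d2 (Cauchy-Schwarz). *)
Lemma defect_radial_lt (R : realType) (s1 s2 a b q t : R) :
  0 < s1 -> 0 < s2 -> 0 <= q -> 0 < rho a q -> 0 < rho b q -> 0 < t ->
  0 <= a * b + q ->
  defect s1 s2 (a * b + q) (rho a q) (rho b q)
    < defect s1 s2 ((a + t * a) * (b + t * a) + (1 + t) ^+ 2 * q)
        (rho (a + t * a) ((1 + t) ^+ 2 * q)) (rho (b + t * a) ((1 + t) ^+ 2 * q)).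
Proof.
move=> s10 s20 q0 d0 e0 t0 p0.
set a' := a + t * a; set b' := b + t * a; set q' := (1 + t) ^+ 2 * q.
have q'0 : 0 <= q' by rewrite mulr_ge0// sqr_ge0.
have [D E] := (rho_sqr a q0, rho_sqr b q0).
have da' : rho a' q' = (1 + t) * rho a q.
  have -> : (1 + t) * rho a q = `|1 + t| * rho a q.
    by rewrite ger0_norm// addr_ge0// ltW.
  rewrite -sqrtr_sqr /rho -sqrtrM ?sqr_ge0//.
  by congr Num.sqrt; rewrite /a' /q'; ring.
have E' : rho b' q' ^+ 2
    = rho b q ^+ 2 + 2 * t * (a * b + q) + t ^+ 2 * rho a q ^+ 2.
  by rewrite rho_sqr// D E /b' /q'; ring.
have hp : a' * b' + q' = (1 + t) * (a * b + q + t * rho a q ^+ 2).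
  by rewrite D /a' /b' /q'; ring.
(* Cauchy-Schwarz for the two offset vectors *)
have CS : (a * b + q) ^+ 2 <= rho a q ^+ 2 * rho b q ^+ 2.
  rewrite D E -subr_ge0.
  have -> : (a ^+ 2 + q) * (b ^+ 2 + q) - (a * b + q) ^+ 2
    = q * (a - b) ^+ 2 by ring.
  by rewrite mulr_ge0// sqr_ge0.
have le_e : rho b q <= rho b' q'.
  rewrite -(@ler_pXn2r _ 2%N) ?nnegrE ?rho_ge0// E' -addrA lerDl.
  by rewrite addr_ge0// ?mulr_ge0 ?sqr_ge0// ltW.
have e'0 : 0 < rho b' q' by exact: lt_le_trans e0 le_e.
apply: defect_lt => //; first by rewrite da' ltr_pMl// ltrDl.
rewrite da' hp; move: (rho a q) (rho b q) (rho b' q') (a * b + q) d0 e0 e'0 p0 E' CS.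
move=> d e e' p d0 e0 e'0 p0 E' CS {D E le_e da' hp}.
have t1 : 0 < 1 + t by rewrite addr_gt0.
have -> : (1 + t) * (p + t * d ^+ 2) / ((1 + t) * d * e')
        = (p + t * d ^+ 2) / (d * e') by field; rewrite !gt_eqF.
rewrite ler_pdivrMr ?mulr_gt0// mulrAC ler_pdivlMr ?mulr_gt0//.
have -> : (p * (d * e') <= (p + t * d ^+ 2) * (d * e))
  = (p * e' <= (p + t * d ^+ 2) * e).
  by rewrite [in RHS]mulrC -[in RHS](ler_pM2l d0); congr (_ <= _); ring.
have td : 0 <= t * d ^+ 2 by rewrite mulr_ge0 ?sqr_ge0// ltW.
rewrite -(@ler_pXn2r _ 2%N) ?nnegrE ?mulr_ge0 ?addr_ge0 ?(ltW e0) ?(ltW e'0)//.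
rewrite !exprMn E' -subr_ge0.
have -> : (p + t * d ^+ 2) ^+ 2 * e ^+ 2
    - p ^+ 2 * (e ^+ 2 + 2 * t * p + t ^+ 2 * d ^+ 2)
  = (2 * t * p + t ^+ 2 * d ^+ 2) * (d ^+ 2 * e ^+ 2 - p ^+ 2) by ring.
by rewrite mulr_ge0 ?subr_ge0// addr_ge0 ?mulr_ge0 ?sqr_ge0// ltW.
Qed.

Lemma rho_lt (R : realType) (a q q' : R) : 0 <= q -> q < q' -> rho a q < rho a q'.
Proof.
move=> q0 qq'; rewrite /rho ltr_sqrt ?ltrD2l//.
by rewrite ltr_wpDl ?sqr_ge0// (le_lt_trans q0).
Qed.

(** The numerator of cos gamma is nonpositive and increases, while its denominator
increases, so cos gamma increases. *)
Lemma defect_transverse_lt (R : realType) (s1 s2 a b q q' : R) :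
  0 < s1 -> 0 < s2 -> 0 < q -> q < q' -> a * b + q <= 0 ->
  defect s1 s2 (a * b + q) (rho a q) (rho b q)
    < defect s1 s2 (a * b + q') (rho a q') (rho b q').
Proof.
move=> s10 s20 q0 qq' p0.
have d0 c : 0 < rho c q by rewrite /rho sqrtr_gt0 ltr_wpDl ?sqr_ge0.
have dd c : rho c q < rho c q' by rewrite rho_lt// ltW.
have d'0 c : 0 < rho c q' := lt_trans (d0 c) (dd c).
apply: defect_lt => //; first exact: ltW.
apply: (@le_trans _ _ ((a * b + q) / (rho a q' * rho b q'))).
  rewrite ler_wnM2l// lef_pV2 ?posrE ?mulr_gt0//.
  by apply: ler_pM; rewrite ?(ltW (d0 _))// ltW.
by rewrite ler_pM2r ?invr_gt0 ?mulr_gt0// lerD2l ltW.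
Qed.

(** Between the foci d1 = a, d2 = - b and cos gamma = -1, while d1 + d2 = a - b is
the distance between the foci; so both s_i d_i are below 1. *)
Lemma defect_segment_lt0 (R : realType) (s1 s2 a b : R) :
  0 < s1 -> 0 < s2 -> b < 0 -> 0 < a ->
  s1 * (a - b) <= 1 -> s2 * (a - b) <= 1 ->
  [/\ s1 * rho a 0 <= 1, s2 * rho b 0 <= 1 &
      defect s1 s2 (a * b + 0) (rho a 0) (rho b 0) < 0].
Proof.
move=> s10 s20 b0 a0 h1 h2.
have -> : rho a 0 = a by rewrite /rho addr0 sqrtr_sqr gtr0_norm.
have -> : rho b 0 = - b by rewrite /rho addr0 sqrtr_sqr ltr0_norm.
have k1 : s1 * a < 1 by nra.
have k2 : s2 * - b < 1 by nra.
split; [exact: ltW|exact: ltW|].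
rewrite /defect addr0.
have -> : a * b / (a * - b) = -1 by field; rewrite (lt_eqF b0) (gt_eqF a0).
have : 0 <= Num.sqrt (1 - (s1 * a) ^+ 2) * Num.sqrt (1 - (s2 * - b) ^+ 2).
  by rewrite mulr_ge0 ?sqrtr_ge0.
have : s1 * a * (s2 * - b) < 1.
  by rewrite mulr_ilt1// mulr_ge0// ?oppr_ge0 ltW.
lra.
Qed.

(** Here p = d1^2 - a (a - b), where a - b is the signed distance between the foci:
it is nonnegative because |a| <= d1 and |a - b| <= 1 / s1 = d1.  Strict
positivity comes from the term s1 d1 s2 d2, the root term being 0. *)
Lemma defect_rim_gt0 (R : realType) (s1 s2 a b q : R) : 0 <= q ->
  0 < s1 -> 0 < s2 -> 0 < rho a q -> 0 < rho b q ->
  s1 * `|a - b| <= 1 -> s1 * rho a q = 1 ->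
  0 < defect s1 s2 (a * b + q) (rho a q) (rho b q).
Proof.
move=> q0 s10 s20 d0 e0 h1 h.
rewrite /defect h expr1n subrr sqrtr0 mul0r subr0 mul1r.
apply: ltr_wpDl; last by rewrite mulr_gt0.
apply: divr_ge0; last by rewrite mulr_ge0// ltW.
have -> : a * b + q = rho a q ^+ 2 - a * (a - b) by rewrite rho_sqr//; ring.
rewrite subr_ge0 (le_trans (ler_norm _))// normrM expr2.
apply: ler_pM => //; first exact: norm_le_rho.
by rewrite -(ler_pM2l s10) h.
Qed.

Lemma defectC (R : realType) (s1 s2 p d1 d2 : R) :
  defect s1 s2 p d1 d2 = defect s2 s1 p d2 d1.
Proof.
by rewrite /defect [d2 * d1]mulrC [s2 * d2 * _]mulrC [in RHS](mulrC (Num.sqrt _)).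
Qed.

(** * The region and the hypersurface in terms of one function *)

Lemma dotp_ge0 (R : realType) (n : nat) (u : 'rV[R]_n) : 0 <= dotp u u.
Proof. by apply: sumr_ge0 => i _; rewrite -expr2 sqr_ge0. Qed.

Lemma enorm_sqr (R : realType) (n : nat) (u : 'rV[R]_n) : enorm u ^+ 2 = dotp u u.
Proof. by rewrite sqr_sqrtr// dotp_ge0. Qed.

Lemma enorm_eq0 (R : realType) (n : nat) (u : 'rV[R]_n) : enorm u = 0 -> u = 0.
Proof.
move=> /(congr1 (fun y => y ^+ 2)); rewrite enorm_sqr expr0n/= => /eqP.
rewrite psumr_eq0 => [/allP h|i _]; last by rewrite -expr2 sqr_ge0.
apply/rowP => i; have := h i (mem_index_enum i).
by rewrite mxE -expr2 sqrf_eq0 => /eqP.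
Qed.

Definition radial2 {R : realType} {n : nat} (x : 'rV[R]_n.+1) : R :=
  enorm (col' ord0 x) ^+ 2.

Lemma radial2_ge0 (R : realType) (n : nat) (x : 'rV[R]_n.+1) : 0 <= radial2 x.
Proof. exact: sqr_ge0. Qed.

Lemma radial2E (R : realType) (n : nat) (x : 'rV[R]_n.+1) :
  radial2 x = \sum_(i < n) x 0 (lift ord0 i) ^+ 2.
Proof.
by rewrite /radial2 enorm_sqr; apply: eq_bigr => i _; rewrite !mxE -expr2.
Qed.

Lemma enorm_sub_axis (R : realType) (n : nat) (x : 'rV[R]_n.+1) (c : R) :
  enorm (x - axis_point c) = rho (x 0 0 - c) (radial2 x).
Proof.
rewrite /enorm /rho /dotp big_ord_recl !mxE eqxx -expr2 radial2E.
by congr (Num.sqrt (_ + _)); apply: eq_bigr => i _; rewrite !mxE subr0 -expr2.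
Qed.

Lemma axis_point00 (R : realType) (n : nat) (c : R) :
  (axis_point c : 'rV[R]_n.+1) 0 0 = c.
Proof. by rewrite mxE eqxx. Qed.

Lemma radial2_axis (R : realType) (n : nat) (c : R) :
  radial2 (axis_point c : 'rV[R]_n.+1) = 0.
Proof. by rewrite radial2E big1// => i _; rewrite mxE expr0n. Qed.

Lemma eq_axis_point (R : realType) (n : nat) (x : 'rV[R]_n.+1) (c : R) :
  (x == axis_point c) = (rho (x 0 0 - c) (radial2 x) == 0).
Proof.
rewrite -enorm_sub_axis; apply/eqP/eqP => [->|/enorm_eq0/eqP].
  by rewrite subrr /enorm /dotp big1 ?sqrtr0// => i _; rewrite !mxE mulr0.
by rewrite subr_eq0 => /eqP.
Qed.

Lemma angle_axis (R : realType) (n : nat) (x : 'rV[R]_n.+1) (c r : R) : 0 < r ->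
  angle (x - axis_point c) (axis_point r - axis_point (- r))
    = acos ((x 0 0 - c) / rho (x 0 0 - c) (radial2 x)).
Proof.
move=> r0; rewrite /angle !enorm_sub_axis axis_point00 radial2_axis.
have -> : rho (r - - r) 0 = r *+ 2.
  by rewrite /rho opprK addr0 sqrtr_sqr ger0_norm -?mulr2n// mulrn_wge0// ltW.
rewrite /dotp big_ord_recl big1 => [|i _]; last first.
  by rewrite !mxE /= !subr0 mulr0.
rewrite addr0 !mxE eqxx opprK -mulr2n -mulf_div divff ?mulr1//.
by rewrite mulrn_eq0/= gt_eqF.
Qed.

Definition gap {R : realType} {n : nat} (s1 s2 r : R) (x : 'rV[R]_n.+1) : R :=
  let a := x 0 0 + r in let b := x 0 0 - r in let q := radial2 x in
  defect s1 s2 (a * b + q) (rho a q) (rho b q).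

(** The points of the two closed balls around the foci, without the foci. *)
Definition admissible {R : realType} {n : nat} (s1 s2 r : R) :
    set 'rV[R]_n.+1 :=
  [set x : 'rV[R]_n.+1 |
    [/\ 0 < rho (x 0 0 + r) (radial2 x), 0 < rho (x 0 0 - r) (radial2 x),
      s1 * rho (x 0 0 + r) (radial2 x) <= 1 &
      s2 * rho (x 0 0 - r) (radial2 x) <= 1]].

Lemma le_radiusE (R : realType) (L s d : R) : 0 < L -> 0 < s ->
  (d <= L / s) = (s / L * d <= 1).
Proof.
by move=> L0 s0; rewrite ler_pdivlMr// mulrAC ler_pdivrMr// mul1r mulrC.
Qed.

(** The distance conditions and [angle_condition] in the coordinates x_1 and
[radial2 x]. *)
Lemma MhatE (R : realType) (n : nat) (r sigma1 sigma2 L : R) :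
  0 < r -> 0 < sigma1 -> 0 < sigma2 -> 0 < L ->
  Mhat sigma1 sigma2 L (axis_point (- r)) (axis_point r)
    = admissible (sigma1 / L) (sigma2 / L) r
      `&` [set x : 'rV[R]_n.+1 | gap (sigma1 / L) (sigma2 / L) r x <= 0].
Proof.
move=> r0 s10 s20 L0; apply/seteqP.
have t10 : 0 < sigma1 / L by rewrite divr_gt0.
have t20 : 0 < sigma2 / L by rewrite divr_gt0.
have ba (z : R) : z - r <= z + r by rewrite lerD2l; lra.
split=> x; rewrite /Mhat /= /phit /psi !enorm_sub_axis !angle_axis// opprK.
  case; rewrite !eq_axis_point opprK !le_radiusE//.
  move=> n1 n2 u1 u2.
  have d1 : 0 < rho (x 0 0 + r) (radial2 x) by rewrite lt_def n1 rho_ge0.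
  have d2 : 0 < rho (x 0 0 - r) (radial2 x) by rewrite lt_def n2 rho_ge0.
  by rewrite angle_condition ?radial2_ge0.
case=> -[d1 d2 u1 u2] h; rewrite !eq_axis_point opprK !le_radiusE// !gt_eqF//.
by split=> //; rewrite angle_condition ?radial2_ge0.
Qed.

(** The defining equation of T_n is gap = 0 divided by d_1 d_2. *)
Lemma TsetE (R : realType) (n : nat) (r sigma1 sigma2 L : R) :
  0 < sigma1 -> 0 < sigma2 -> 0 < L ->
  Tset r sigma1 sigma2 L
    = admissible (sigma1 / L) (sigma2 / L) r
      `&` [set x : 'rV[R]_n.+1 | gap (sigma1 / L) (sigma2 / L) r x = 0].
Proof.
move=> s10 s20 L0; apply/seteqP.
have key (x : 'rV[R]_n.+1) :
    0 < rho (x 0 0 + r) (radial2 x) -> 0 < rho (x 0 0 - r) (radial2 x) ->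
    (x 0 0 ^+ 2 + radial2 x - r ^+ 2)
        / (rho (x 0 0 + r) (radial2 x) ^+ 2 * rho (x 0 0 - r) (radial2 x) ^+ 2)
      + sigma1 * sigma2 / L ^+ 2
    - Num.sqrt (1 / rho (x 0 0 + r) (radial2 x) ^+ 2 - sigma1 ^+ 2 / L ^+ 2)
      * Num.sqrt (1 / rho (x 0 0 - r) (radial2 x) ^+ 2 - sigma2 ^+ 2 / L ^+ 2)
    = gap (sigma1 / L) (sigma2 / L) r x
      / (rho (x 0 0 + r) (radial2 x) * rho (x 0 0 - r) (radial2 x)).
  rewrite /gap /=.
  have -> : (x 0 0 + r) * (x 0 0 - r) + radial2 x
     = x 0 0 ^+ 2 + radial2 x - r ^+ 2 by ring.
  move: (rho _ _) (rho _ _) => d1 d2 d10 d20.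
  have rt (s d : R) : 0 < d -> Num.sqrt (1 / d ^+ 2 - s ^+ 2 / L ^+ 2)
      = Num.sqrt (1 - (s / L * d) ^+ 2) / d.
    move=> d0.
    have -> : 1 / d ^+ 2 - s ^+ 2 / L ^+ 2 = (1 - (s / L * d) ^+ 2) * d^-1 ^+ 2.
      by field; rewrite !gt_eqF.
    by rewrite mulrC sqrtrM ?sqr_ge0// sqrtr_sqr ger0_norm ?invr_ge0 1?ltW// mulrC.
  by rewrite !rt// /defect; field; rewrite !gt_eqF.
split=> x; rewrite /Tset /= -!/(rho _ _) -/(radial2 x) -/(rho _ _).
  case=> /andP[d1 u1] /andP[d2 u2] /eqP; rewrite -subr_eq0 key//.
  rewrite mulf_eq0 invr_eq0 mulf_eq0 !(gt_eqF d1, gt_eqF d2) !orbF => /eqP h.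
  by split=> //; split=> //; rewrite -le_radiusE.
case=> -[d1 d2 u1 u2] h; split; rewrite ?d1 ?d2 ?le_radiusE//.
by apply/eqP; rewrite -subr_eq0 key// h mul0r.
Qed.

(** * Sign and growth of the gap *)

(** Homotheties centred on the axis serve for every motion used below: away from a
focus, away from the axis (centre at the projection of the point), and along the
axis. *)
Lemma homothety_coord0 (R : realType) (n : nat) (x : 'rV[R]_n.+1) (c t : R) :
  (x + t *: (x - axis_point c)) 0 0 = x 0 0 + t * (x 0 0 - c).
Proof. by rewrite !mxE eqxx. Qed.

Lemma homothety_radial2 (R : realType) (n : nat) (x : 'rV[R]_n.+1) (c t : R) :
  radial2 (x + t *: (x - axis_point c)) = (1 + t) ^+ 2 * radial2 x.
Proof.
rewrite !radial2E mulr_sumr; apply: eq_bigr => i _.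
by rewrite !mxE /= subr0 -exprMn mulrDl mul1r.
Qed.

Lemma gap_lt_away_focus (R : realType) (n : nat) (s1 s2 r t : R)
    (x : 'rV[R]_n.+1) :
  0 < s1 -> 0 < s2 -> 0 < t -> admissible s1 s2 r x ->
  0 <= (x 0 0 + r) * (x 0 0 - r) + radial2 x ->
  gap s1 s2 r x < gap s1 s2 r (x + t *: (x - axis_point (- r))).
Proof.
move=> s10 s20 t0 [d1 d2 _ _] p0.
have := defect_radial_lt s10 s20 (radial2_ge0 x) d1 d2 t0 p0.
rewrite /gap homothety_coord0 homothety_radial2 opprK.
by rewrite (addrAC _ _ r) (addrAC _ _ (- r)).
Qed.

Lemma gap_lt_away_axis (R : realType) (n : nat) (s1 s2 r t : R)
    (x : 'rV[R]_n.+1) :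
  0 < s1 -> 0 < s2 -> 0 < t -> 0 < radial2 x ->
  (x 0 0 + r) * (x 0 0 - r) + radial2 x <= 0 ->
  gap s1 s2 r x < gap s1 s2 r (x + t *: (x - axis_point (x 0 0))).
Proof.
move=> s10 s20 t0 q0 p0.
rewrite /gap homothety_coord0 homothety_radial2 subrr mulr0 addr0.
by apply: defect_transverse_lt => //; rewrite ltr_pMl//; nra.
Qed.

Lemma gap_segment_lt0 (R : realType) (n : nat) (s1 s2 r : R)
    (x : 'rV[R]_n.+1) :
  0 < s1 -> 0 < s2 -> s1 * (2 * r) <= 1 -> s2 * (2 * r) <= 1 ->
  radial2 x = 0 -> - r < x 0 0 -> x 0 0 < r ->
  admissible s1 s2 r x /\ gap s1 s2 r x < 0.
Proof.
move=> s10 s20 h1 h2 q0 l1 l2.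
have a0 : 0 < x 0 0 + r by lra.
have b0 : x 0 0 - r < 0 by lra.
have e : x 0 0 + r - (x 0 0 - r) = 2 * r by ring.
have [] := @defect_segment_lt0 _ s1 s2 _ _ s10 s20 b0 a0; rewrite ?e// => u1 u2 h.
rewrite /gap /admissible /= q0; split=> //; split=> //.
  by rewrite /rho addr0 sqrtr_sqr normr_gt0 gt_eqF.
by rewrite /rho addr0 sqrtr_sqr normr_gt0 lt_eqF.
Qed.

(** The gap is positive on the two limiting spheres, so a point where it is negative
avoids them; it is [defect_rim_gt0] for each focus. *)
Lemma admissible_gap_lt0 (R : realType) (n : nat) (s1 s2 r : R)
    (x : 'rV[R]_n.+1) :
  0 < s1 -> 0 < s2 -> 0 < r -> s1 * (2 * r) <= 1 -> s2 * (2 * r) <= 1 ->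
  admissible s1 s2 r x -> gap s1 s2 r x < 0 ->
  s1 * rho (x 0 0 + r) (radial2 x) < 1 /\ s2 * rho (x 0 0 - r) (radial2 x) < 1.
Proof.
move=> s10 s20 r0 h1 h2 [d1 d2 u1 u2] g0.
have q0 := radial2_ge0 x.
have e : `|x 0 0 + r - (x 0 0 - r)| = 2 * r.
  have -> : x 0 0 + r - (x 0 0 - r) = 2 * r by ring.
  by rewrite gtr0_norm// mulr_gt0.
split; rewrite lt_neqAle ?u1 ?u2 andbT; apply/eqP => E.
  have := defect_rim_gt0 q0 s10 s20 d1 d2; rewrite e => /(_ h1 E).
  by rewrite ltNge ltW.
have := defect_rim_gt0 q0 s20 s10 d2 d1; rewrite distrC e => /(_ h2 E).
by rewrite defectC mulrC ltNge ltW.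
Qed.

(** * Topology of the sublevel set *)

Lemma continuous_sqr (R : realType) (T : topologicalType) (f : T -> R) :
  continuous f -> continuous (fun x => f x ^+ 2).
Proof.
move=> cf x.
apply: (@continuous_comp _ R R f (fun y => y ^+ 2)); first exact: cf.
exact: exprn_continuous.
Qed.

Lemma continuous_sqrt (R : realType) (T : topologicalType) (f : T -> R) :
  continuous f -> continuous (fun x => Num.sqrt (f x)).
Proof.
move=> cf x; apply: (@continuous_comp _ R R f (@Num.sqrt R)); first exact: cf.
exact: (@sqrt_continuous R).
Qed.

Lemma continuous_radial2 (R : realType) (n : nat) :
  continuous (@radial2 R n).
Proof.
have -> : @radial2 R n = (fun x => \sum_(i < n) x 0 (lift ord0 i) ^+ 2).
  by apply/funext => x; rewrite radial2E.
apply: continuous_big => [|i _]; first exact: add_continuous.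
apply: (@continuous_sqr R _ (fun y : 'rV[R]_n.+1 => y 0 (lift ord0 i))).
exact: coord_continuous.
Qed.

Lemma continuous_rho (R : realType) (n : nat) (c : R) :
  continuous (fun x : 'rV[R]_n.+1 => rho (x 0 0 + c) (radial2 x)).
Proof.
apply: (@continuous_sqrt R _ (fun y : 'rV[R]_n.+1 => (y 0 0 + c) ^+ 2 + radial2 y)).
move=> x; apply: (@cvgD _ _ _ (nbhs x)); last exact: continuous_radial2.
apply: (@continuous_sqr R _ (fun y : 'rV[R]_n.+1 => y 0 0 + c)) => y.
by apply: (@cvgD _ _ _ (nbhs y)); [exact: coord_continuous|exact: cvg_cst].
Qed.

Lemma near_right_ray (R : realType) (n : nat) (x v : 'rV[R]_n) (A : set 'rV[R]_n)
    (e : R) :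
  nbhs x A -> 0 < e -> exists t, [/\ 0 < t, t < e & A (x + t *: v)].
Proof.
move=> Ax e0.
have cv : x + t *: v @[t --> (0 : R)^'+] --> x.
  apply: cvg_at_right_filter; rewrite -[in X in _ --> X](addr0 x) -(scale0r v).
  by apply: cvgD; [exact: cvg_cst|exact: cvgZr_tmp].
have : \forall t \near (0 : R)^'+, [/\ 0 < t, t < e & A (x + t *: v)].
  near=> t; split; near: t; [exact: nbhs_right_gt|exact: nbhs_right_lt|exact: cv].
by move=> /filter_ex.
Unshelve. all: by end_near. Qed.

(** Along a suitable ray the gap is positive at once, which excludes the points of
that ray from the region, whether or not they stay in the two balls. *)
Lemma gap_eq0_not_interior (R : realType) (n : nat) (s1 s2 r : R)
    (x : 'rV[R]_n.+1) :
  0 < s1 -> 0 < s2 -> 0 < r -> s1 * (2 * r) <= 1 -> s2 * (2 * r) <= 1 ->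
  admissible s1 s2 r x -> gap s1 s2 r x = 0 ->
  ~ (admissible s1 s2 r `&` [set y : 'rV[R]_n.+1 | gap s1 s2 r y <= 0])° x.
Proof.
move=> s10 s20 r0 h1 h2 adm g0.
have [v hv] : exists v, forall t, 0 < t -> 0 < gap s1 s2 r (x + t *: v).
  have [p0|p0] := leP 0 ((x 0 0 + r) * (x 0 0 - r) + radial2 x).
    exists (x - axis_point (- r)) => t t0.
    by rewrite -g0; exact: gap_lt_away_focus.
  have := radial2_ge0 x; rewrite le0r => /predU1P[q0|q0].
    (* on the axis p < 0 reads (z1 + r) (z1 - r) < 0: x is between the foci *)
    have [z1 z2] : - r < x 0 0 /\ x 0 0 < r by split; nra.
    have [_] := gap_segment_lt0 s10 s20 h1 h2 q0 z1 z2.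
    by rewrite g0 ltxx.
  exists (x - axis_point (x 0 0)) => t t0.
  by rewrite -g0; apply: gap_lt_away_axis => //; exact: ltW.
move=> /(near_right_ray v) /(_ ltr01)[t [t0 _ [_ /=]]].
by rewrite leNgt hv.
Qed.

(** The homothety with centre 2 c moves the focus c to (1 - t) c, that is, into the
open segment between the foci. *)
Lemma focus_closure (R : realType) (n : nat) (s1 s2 r c : R) :
  0 < s1 -> 0 < s2 -> 0 < r -> s1 * (2 * r) <= 1 -> s2 * (2 * r) <= 1 ->
  `|c| = r ->
  closure (admissible s1 s2 r `&` [set y : 'rV[R]_n.+1 | gap s1 s2 r y <= 0])
    (axis_point c).
Proof.
move=> s10 s20 r0 h1 h2 cr B Bc.
have [t [t0 t1 Bt]] :=
  near_right_ray (axis_point c - axis_point (2 * c)) Bc ltr01.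
exists (axis_point c + t *: (axis_point c - axis_point (2 * c))); split=> //.
have : `|c + t * (c - 2 * c)| < r.
  have -> : c + t * (c - 2 * c) = (1 - t) * c by ring.
  rewrite normrM cr gtr0_norm; last by rewrite subr_gt0.
  by rewrite gtr_pMl// ltrBlDr ltrDl.
rewrite ltr_norml => /andP[l1 l2].
set y := axis_point c + _ *: _.
have [|||adm /ltW//] := @gap_segment_lt0 R n s1 s2 r y s10 s20 h1 h2.
- by rewrite homothety_radial2 radial2_axis mulr0.
- by rewrite homothety_coord0 axis_point00.
- by rewrite homothety_coord0 axis_point00.
Qed.

Lemma continuous_gap (R : realType) (n : nat) (s1 s2 r : R)
    (x : 'rV[R]_n.+1) :
  0 < rho (x 0 0 + r) (radial2 x) -> 0 < rho (x 0 0 - r) (radial2 x) ->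
  {for x, continuous (@gap R n s1 s2 r)}.
Proof.
move=> d1 d2.
have cd c : continuous (fun y : 'rV[R]_n.+1 => rho (y 0 0 + c) (radial2 y)).
  exact: continuous_rho.
have cs s c : continuous (fun y : 'rV[R]_n.+1 => s * rho (y 0 0 + c) (radial2 y)).
  by move=> y; apply: (@cvgM _ _ (nbhs y)); [exact: cvg_cst|exact: cd].
have cz c : continuous (fun y : 'rV[R]_n.+1 => y 0 0 + c).
  move=> y; apply: (@cvgD _ _ _ (nbhs y)); first exact: coord_continuous.
  exact: cvg_cst.
have cq s c : continuous (fun y : 'rV[R]_n.+1 =>
    Num.sqrt (1 - (s * rho (y 0 0 + c) (radial2 y)) ^+ 2)).
  apply: (@continuous_sqrt R _ (fun y : 'rV[R]_n.+1 =>
    1 - (s * rho (y 0 0 + c) (radial2 y)) ^+ 2)) => y.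
  apply: (@cvgB _ _ _ (nbhs y)); first exact: cvg_cst.
  exact: (@continuous_sqr R _
    (fun y : 'rV[R]_n.+1 => s * rho (y 0 0 + c) (radial2 y))).
apply: (@cvgB _ _ _ (nbhs x)).
  apply: (@cvgD _ _ _ (nbhs x)).
    apply: (@cvgM _ _ (nbhs x)).
      apply: (@cvgD _ _ _ (nbhs x)); last exact: continuous_radial2.
      by apply: (@cvgM _ _ (nbhs x)); exact: cz.
    apply: (@cvgV _ _ (nbhs x)); first by rewrite mulf_neq0// gt_eqF.
    by apply: (@cvgM _ _ (nbhs x)); exact: cd.
  by apply: (@cvgM _ _ (nbhs x)); exact: cs.
by apply: (@cvgM _ _ (nbhs x)); exact: cq.
Qed.

(** The five conditions are strict at such a point, hence stable. *)
Lemma gap_lt0_interior (R : realType) (n : nat) (s1 s2 r : R)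
    (x : 'rV[R]_n.+1) :
  0 < s1 -> 0 < s2 -> 0 < r -> s1 * (2 * r) <= 1 -> s2 * (2 * r) <= 1 ->
  admissible s1 s2 r x -> gap s1 s2 r x < 0 ->
  (admissible s1 s2 r `&` [set y : 'rV[R]_n.+1 | gap s1 s2 r y <= 0])° x.
Proof.
move=> s10 s20 r0 h1 h2 adm g0.
have [u1 u2] := admissible_gap_lt0 s10 s20 r0 h1 h2 adm g0.
case: adm => d1 d2 _ _.
have e (s d : R) : 0 < s -> (s * d < 1) = (d < s^-1).
  by move=> s0; rewrite -ltr_pdivlMl// mulr1.
move: u1 u2; rewrite !e// => u1 u2.
have c c' := @continuous_rho R n c' x.
have cg : gap s1 s2 r y @[y --> x] --> gap s1 s2 r x by exact: continuous_gap.
near=> y; split=> /=.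
  split; near: y.
  - exact: (cvgr_gt _ (c r)).
  - exact: (cvgr_gt _ (c (- r))).
  - by near do rewrite ltW// e//; exact: (cvgr_lt _ (c r)).
  - by near do rewrite ltW// e//; exact: (cvgr_lt _ (c (- r))).
by near: y; near do rewrite ltW//; exact: (cvgr_lt _ cg).
Unshelve. all: by end_near. Qed.

(** The gap is continuous except at the foci, so non-strict inequalities pass to the
limit there. *)
Lemma closure_sublevel (R : realType) (n : nat) (s1 s2 r : R)
    (x : 'rV[R]_n.+1) :
  0 < s1 -> 0 < s2 ->
  closure (admissible s1 s2 r `&` [set y : 'rV[R]_n.+1 | gap s1 s2 r y <= 0]) x ->
  x != axis_point (- r) -> x != axis_point r ->
  admissible s1 s2 r x /\ gap s1 s2 r x <= 0.
Proof.
move=> s10 s20 cl; rewrite !eq_axis_point opprK => n1 n2.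
have d1 : 0 < rho (x 0 0 + r) (radial2 x) by rewrite lt_def n1 rho_ge0.
have d2 : 0 < rho (x 0 0 - r) (radial2 x) by rewrite lt_def n2 rho_ge0.
have e (s d : R) : 0 < s -> (s * d <= 1) = (d <= s^-1).
  by move=> s0; rewrite -ler_pdivlMl// mulr1.
have c c' := @continuous_rho R n c' x.
split; first split=> //.
- rewrite e// leNgt; apply/negP => /(cvgr_gt _ (c r))/cl[y [[[_ _ + _] _]]] /=.
  by rewrite e// leNgt => /negP.
- rewrite e// leNgt; apply/negP => /(cvgr_gt _ (c (- r)))/cl[y [[[_ _ _ +] _]]] /=.
  by rewrite e// leNgt => /negP.
rewrite leNgt; apply/negP.
have cg : gap s1 s2 r y @[y --> x] --> gap s1 s2 r x by exact: continuous_gap.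
move=> /(cvgr_gt _ cg)/cl[y [[_ /=]]].
by rewrite leNgt => /negP.
Qed.

Lemma boundary_sublevel (R : realType) (n : nat) (s1 s2 r : R) :
  0 < s1 -> 0 < s2 -> 0 < r -> s1 * (2 * r) <= 1 -> s2 * (2 * r) <= 1 ->
  boundary (admissible s1 s2 r `&` [set y : 'rV[R]_n.+1 | gap s1 s2 r y <= 0])
    = (admissible s1 s2 r `&` [set y : 'rV[R]_n.+1 | gap s1 s2 r y = 0])
      `|` [set axis_point (- r); axis_point r].
Proof.
move=> s10 s20 r0 h1 h2; apply/seteqP; split=> x.
  case=> cl ni.
  have [->|n1] := eqVneq x (axis_point (- r)); first by right; left.
  have [->|n2] := eqVneq x (axis_point r); first by right; right.
  have [adm] := closure_sublevel s10 s20 cl n1 n2.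
  rewrite le_eqVlt => /predU1P[g0|g0]; first by left.
  by case: ni; exact: gap_lt0_interior.
have foc (c : R) (cr : `|c| = r) := @focus_closure R n s1 s2 r c s10 s20 r0 h1 h2 cr.
case=> [[adm g0]|[]->].
- split; last exact: gap_eq0_not_interior.
  by apply: subset_closure; split=> //=; rewrite g0.
- split; first by apply: foc; rewrite normrN gtr0_norm.
  move=> /interior_subset[[+ _ _ _] _].
  by rewrite axis_point00 radial2_axis addNr /rho expr0n addr0 sqrtr0 ltxx.
- split; first by apply: foc; rewrite gtr0_norm.
  move=> /interior_subset[[_ + _ _] _].
  by rewrite axis_point00 radial2_axis subrr /rho expr0n addr0 sqrtr0 ltxx.
Qed.

Theorem theorem1 (R : realType) (n : nat) (r sigma1 sigma2 L : R)
    (r_gt0 : 0 < r) (sigma1_gt0 : 0 < sigma1) (sigma2_gt0 : 0 < sigma2)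
    (L_gt0 : 0 < L)
    (hr : r <= L / 2 * Num.min (1 / sigma1) (1 / sigma2)) :
  let x1 : 'rV[R]_n.+1 := axis_point (- r) in
  let x2 : 'rV[R]_n.+1 := axis_point r in
  boundary (Mhat sigma1 sigma2 L x1 x2)
    = Tset r sigma1 sigma2 L `|` [set x1; x2].
Proof.
move=> x1 x2; rewrite MhatE// TsetE//.
have half (s : R) : 0 < s -> Num.min (1 / sigma1) (1 / sigma2) <= 1 / s ->
    s / L * (2 * r) <= 1.
  move=> s0 ms; have h : r <= L / 2 * (1 / s).
    by apply: (le_trans hr); rewrite ler_pM2l ?divr_gt0.
  have -> : s / L * (2 * r) = r / (L / 2 * (1 / s)) by field; rewrite !gt_eqF.
  have Ls : 0 < L / 2 * (1 / s) by rewrite mulr_gt0 ?divr_gt0.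
  by rewrite (ler_pdivrMr _ _ Ls) [leRHS]mul1r.
by apply: boundary_sublevel; rewrite ?divr_gt0// half// ge_min lexx ?orbT.
Qed.
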